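(* A graph $G$ with $n$ vertices is uniquely $k$-colorable if and only if the reduced Gröbner basis for $I_{G,k}$ with respect to any term order $\prec$ with $x_n\prec\cdots\prec x_1$ has the form $\{\tilde g_1,\ldots,\tilde g_n\}$, where $\{\tilde g_1,\ldots,\tilde g_n\}$ is the reduced $\nu$-basis (defined in the context) of some proper $k$-coloring $\nu$ of $G$ that uses all $k$ colors.
   Context: $G$ is a simple undirected graph with vertex set $V=\{1,\ldots,n\}$ and edge set $E$. $k$ is a fixed positive integer with $k<n$. $C_k$ is a fixed set of $k$ colors; a $k$-coloring of $G$ is a map $\nu:V\to C_k$, and it is proper if adjacent vertices receive different colors. $G$ is uniquely $k$-colorable if there is a unique proper $k$-coloring of $G$ up to permutation of the colors in $C_k$. $\Bbbk$ is an algebraically closed field of characteristic not dividing $k$, and $R=\Bbbk[x_1,\ldots,x_n]$. The ideal $I_{G,k}\subseteq R$ is generated by the polynomials $x_i^k-1$ for all $i\in V$ together with $x_i^{k-1}+x_i^{k-2}x_j+\cdots+x_ix_j^{k-2}+x_j^{k-1}$ for all $\{i,j\}\in E$. A term order is a well-ordering of the monomials of $R$ that is multiplicative ($u\prec v$ implies $wu\prec wv$ for monomials $u,v,w$) and for which the constant monomial $1$ is smallest. The leading monomial of a polynomial is its largest monomial with respect to $\prec$. A Gröbner basis of an ideal $I$ with respect to $\prec$ is a finite subset of $I$ whose leading monomials generate the ideal generated by the leading monomials of all elements of $I$. A reduced Gröbner basis $\mathcal G$ is a Gröbner basis such that the coefficient of the leading monomial of each $g\in\mathcal G$ is $1$ and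 the leading monomial of any $g\in\mathcal G$ does not divide any monomial occurring in another polynomial in $\mathcal G$; given a term order, reduced Gröbner bases exist and are unique. For $U\subseteq V$ and an integer $d\ge 0$, $h_U^d$ denotes the sum of all monomials of degree $d$ in the indeterminates $\{x_i: i\in U\}$, with $h_U^0=1$. Reduced $\nu$-basis: let $\nu$ be a proper $k$-coloring of $G$ for which the number $l$ of distinct colors in $\nu(V)$ equals $k$. The color class $cl(i)$ of a vertex $i$ is the set of vertices with the same color as $i$, and the maximum of a color class is the largest vertex contained in it. Let $m_1<m_2<\cdots<m_l=n$ be the maximums of the $l$ color classes. For each $i\in V$ define $$\tilde g_i=\begin{cases}x_i^k-1 & \text{if } i=m_l,\\ h^{j}_{\{m_j,\ldots,m_l\}} & \text{if } i=m_j \text{ for some } j\ne l,\\ h^1_{\{i,m_2,\ldots,m_l\}} & \text{if } i\in cl(m_1),\\ x_i-x_{\max cl(i)} & \text{otherwise.}\end{cases}$$ The set $\{\tilde g_1,\ldots,\tilde g_n\}$ is called a reduced $\nu$-basis.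
   Formalization: The case k = 1 is excluded (k ≥ 2 is assumed): for k = 1 and G without edges, G is uniquely 1-colorable, but the reduced ν-basis contains x_i for i < n instead of x_i − 1, so it is not in the ideal and the claim fails. *)

(* Defs.v *)
From HB Require Import structures.
From mathcomp Require Import all_boot all_order all_fingroup all_algebra.
From mathcomp Require Import mpoly.

Set Implicit Arguments.
Unset Strict Implicit.
Unset Printing Implicit Defensive.

Import GRing.Theory.
Local Open Scope ring_scope.

(* The vertices 1, ..., n are the elements 0, ..., n.-1 of 'I_n. *)

Section Colorings.

Variables (n : nat) (C : finType) (e : rel 'I_n).

Definition proper_coloring (nu : {ffun 'I_n -> C}) : Prop :=
  forall i j : 'I_n, e i j -> nu i != nu j.

Definition uniquely_colorable : Prop :=
  exists nu : {ffun 'I_n -> C}, proper_coloring nu /\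
    forall nu' : {ffun 'I_n -> C}, proper_coloring nu' ->
      exists s : {perm C}, forall i : 'I_n, nu' i = s (nu i).

End Colorings.

Section ColorClasses.

Variables (n : nat) (C : finType) (nu : {ffun 'I_n -> C}).

Definition color_class (i : 'I_n) : {set 'I_n} := [set j | nu j == nu i].

Definition max_class (i : 'I_n) : 'I_n :=
  [arg max_(j > i in color_class i) j]%N.

(* The list [:: m_1; ...; m_l], with m_1 < ... < m_l because enum 'I_n is
   increasing. *)
Definition class_maxima : seq 'I_n :=
  [seq i <- enum 'I_n | max_class i == i].

End ColorClasses.

Definition ideal_gen (R : comNzRingType) (S : R -> Prop) (p : R) : Prop :=
  exists s : seq (R * R),
    (forall t, t \in s -> S t.2) /\ p = \sum_(t <- s) t.1 * t.2.

(* prec u v reads "u is strictly smaller than v"; monomials are multiplied by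
   adding their exponents, and 0%MM is the constant monomial. *)
Record term_order (n : nat) (prec : rel 'X_{1..n}) : Prop := TermOrder {
  prec_irr : irreflexive prec;
  prec_trans : transitive prec;
  prec_total : forall u v, u != v -> prec u v || prec v u;
  prec_wf : well_founded (fun u v => prec u v);
  prec_mul : forall u v w, prec u v -> prec (w + u)%MM (w + v)%MM;
  prec_min : forall u, u != 0%MM -> prec 0%MM u
}.

Section Groebner.

Variables (n : nat) (F : fieldType) (prec : rel 'X_{1..n}).

(* Never holds for p = 0. *)
Definition is_lm (p : {mpoly F[n]}) (m : 'X_{1..n}) : Prop :=
  m \in msupp p /\ forall m', m' \in msupp p -> m' != m -> prec m' m.

Definition lm_ideal (S : {mpoly F[n]} -> Prop) : {mpoly F[n]} -> Prop :=
  ideal_gen (fun q => exists p m, [/\ S p, is_lm p m & q = 'X_[m]]).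

Definition groebner_basis (I : {mpoly F[n]} -> Prop) (B : seq {mpoly F[n]}) :
    Prop :=
  (forall g, g \in B -> I g) /\
  forall q, lm_ideal (fun g => g \in B) q <-> lm_ideal I q.

Definition reduced_groebner_basis (I : {mpoly F[n]} -> Prop)
    (B : seq {mpoly F[n]}) : Prop :=
  [/\ groebner_basis I B,
      forall g, g \in B -> exists2 m, is_lm g m & g@_m = 1
    & forall g g' m m', g \in B -> g' \in B -> g' != g ->
        is_lm g m -> m' \in msupp g' -> ~~ (m <= m')%MM].

End Groebner.

Section ColoringIdeal.

Variables (n k : nat) (F : fieldType).

Definition coloring_ideal (e : rel 'I_n) : {mpoly F[n]} -> Prop :=
  ideal_gen (fun p : {mpoly F[n]} =>
    (exists i : 'I_n, p = 'X_i ^+ k - 1) \/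
    (exists i j : 'I_n,
       e i j /\ p = \sum_(a < k) 'X_i ^+ (k.-1 - a) * 'X_j ^+ a)).

(* The complete homogeneous polynomial h_U^d; the bound in the type
   'X_{1..n < d.+1} only serves to make the index set finite. *)
Definition hsym (U : {set 'I_n}) (d : nat) : {mpoly F[n]} :=
  \sum_(m : 'X_{1..n < d.+1} |
        (mdeg m == d) && [forall i, (i \notin U) ==> (m i == 0%N)]) 'X_[m].

(* With M = [:: m_1; ...; m_l], the entry m_j has index j.-1 in M. *)
Definition nu_poly (C : finType) (nu : {ffun 'I_n -> C}) (i : 'I_n) :
    {mpoly F[n]} :=
  let M := class_maxima nu in
  if i == last i M then 'X_i ^+ k - 1
  else if i \in M then
    hsym [set m in drop (index i M) M] (index i M).+1
  else if i \in color_class nu (head i M) then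
    hsym (i |: [set m in behead M]) 1%N
  else 'X_i - 'X_(max_class nu i).

Definition nu_basis (C : finType) (nu : {ffun 'I_n -> C}) :
    seq {mpoly F[n]} :=
  [seq nu_poly nu i | i <- enum 'I_n].

End ColoringIdeal.

(* Main.v *)
Require Import Defs.
From HB Require Import structures.
From mathcomp Require Import all_boot all_order all_fingroup all_algebra.
From mathcomp Require Import separable cyclotomic.
From mathcomp Require Import mpoly.

Set Implicit Arguments.
Unset Strict Implicit.
Unset Printing Implicit Defensive.

Import GRing.Theory.
Local Open Scope ring_scope.

(** Write z for a bijection from the colors to the k-th roots of unity of F.
A coloring nu' is a point z \o nu' of the grid of n-tuples of such roots, and
the edge polynomials vanish there exactly when nu' is proper.  The polynomials
'X_i ^+ k - 1 split into distinct linear factors, so Lagrange interpolation on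
the grid shows that coloring_ideal is the ideal of all polynomials vanishing at
the proper colorings (coloring_nullstellensatz, coloring_ideal_point).

The leading monomial of g_i := nu_poly nu i is a power 'X_i ^+ d_i of its own
variable: d_i = j when i = m_j, and d_i = 1 when i is not the maximum of its
class.  Hence exactly \prod_i d_i = k`! monomials are standard, that is,
divisible by none of these leading monomials.  Division by the g_i replaces any
polynomial by a combination of standard monomials without changing its values
at a common zero of the g_i.  Finitely many common zeros are separated by
polynomials, so there are at most k`! of them (card_points_le); if there are
exactly k`!, the matrix of values of the standard monomials is square and
invertible, so no nonzero combination of standard monomials vanishes at all of
them, and every polynomial that does vanish has a leading monomial divisible by
some 'X_i ^+ d_i (lm_vanish_not_standard).

Both directions follow by counting.  Permuting the colors of nu yields k`!
proper colorings.  If there are no others, the g_i vanish at all proper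
colorings, because the complete homogeneous polynomial of degree j in k + 1 - j
distinct k-th roots of unity is 0 for 0 < j < k (hsym_roots_of_unity); so the
g_i belong to the ideal, and they form a Groebner basis since all k`! common
zeros are accounted for.  Conversely, if the g_i belong to the ideal, every
proper coloring is a common zero of theirs, so that there are at most k`! proper
colorings: the permuted colorings of nu are all of them.  The term order here is
the graded lexicographic one. *)

(** * Generated ideals *)

Section GeneratedIdeals.

Variables (R : comNzRingType) (S : R -> Prop).

Lemma ideal_gen0 : ideal_gen S 0.
Proof. by exists [::]; rewrite big_nil. Qed.

Lemma ideal_genMl q p : S p -> ideal_gen S (q * p).
Proof.
move=> Sp; exists [:: (q, p)]; rewrite big_seq1; split=> // t.
by rewrite inE => /eqP ->.
Qed.

Lemma ideal_genD p q : ideal_gen S p -> ideal_gen S q -> ideal_gen S (p + q).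
Proof.
move=> [s [Ss ->]] [t [St ->]]; exists (s ++ t); rewrite big_cat; split=> // u.
by rewrite mem_cat => /orP[/Ss | /St].
Qed.

Lemma ideal_genM q p : ideal_gen S p -> ideal_gen S (q * p).
Proof.
move=> [s [Ss ->]]; exists [seq (q * t.1, t.2) | t <- s]; split.
  by move=> _ /mapP[t /Ss St ->].
by rewrite big_map mulr_sumr; apply: eq_bigr => t _; rewrite mulrA.
Qed.

Lemma ideal_gen_sum (I : finType) (f : I -> R) :
  (forall i, ideal_gen S (f i)) -> ideal_gen S (\sum_i f i).
Proof.
move=> Sf; apply: (big_ind (ideal_gen S)) => //.
  exact: ideal_gen0.
exact: ideal_genD.
Qed.

End GeneratedIdeals.

Lemma ideal_gen_sub (R : comNzRingType) (S S' : R -> Prop) p :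
  (forall q, S q -> ideal_gen S' q) -> ideal_gen S p -> ideal_gen S' p.
Proof.
move=> sSS' [s [Ss ->]]; elim: s Ss => [|t s IHs] Ss.
  by rewrite big_nil; apply: ideal_gen0.
rewrite big_cons; apply: ideal_genD.
  by apply/ideal_genM/sSS'/Ss; rewrite mem_head.
by apply: IHs => u su; apply: Ss; rewrite inE su orbT.
Qed.

(** * The coloring ideal consists of what vanishes at the proper colorings *)

Lemma roots_of_unity_param (F : closedFieldType) (C : finType) :
  #|C|%:R != 0 :> F ->
  exists2 z : C -> F, injective z & 'X^#|C| - 1 = \prod_c ('X - (z c)%:P).
Proof.
move=> k_neq0; have [r Dr] := closed_field_poly_normal ('X^#|C| - 1 : {poly F}).
have k_gt0 : (0 < #|C|)%N by rewrite lt0n; apply: contraNneq k_neq0 => ->.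
move: Dr; rewrite lead_coefXnsubC // scale1r => Dr.
have sz_r : size r = #|C|.
  by apply: succn_inj; rewrite -(size_prod_XsubC r id) -Dr size_XnsubC.
have uniq_r : uniq r by rewrite -separable_prod_XsubC -Dr separable_Xn_sub_1.
exists (fun c => r`_(enum_rank c)).
  move=> c c' /eqP; rewrite nth_uniq ?sz_r ?ltn_ord // => /eqP rank_cc'.
  exact/enum_rank_inj/val_inj.
rewrite Dr (big_nth 0) big_mkord sz_r (reindex enum_rank) //.
by exists enum_val => c _; rewrite ?enum_rankK ?enum_valK.
Qed.

Lemma proper_coloringP n (C : finType) (e : rel 'I_n)
    (nu : {ffun 'I_n -> C}) :
  reflect (proper_coloring e nu) [forall i, forall j, e i j ==> (nu i != nu j)].
Proof.
apply: (iffP 'forall_forallP) => nuP i j; first exact/implyP.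
by apply/implyP; apply: nuP.
Qed.

Section Interpolation.

Variables (n k : nat) (F : fieldType) (C : finType) (z : C -> F).
Hypotheses (z_inj : injective z) (cardC : #|C| = k) (k_neq0 : k%:R != 0 :> F).
Hypothesis z_roots : 'X^k - 1 = \prod_c ('X - (z c)%:P).

Lemma root_of_unity c : z c ^+ k = 1.
Proof.
apply/eqP; rewrite -subr_eq0 -(hornerXn (z c) k) -(hornerC 1 (z c)) -hornerN.
by rewrite -hornerD z_roots horner_prod (bigD1 c) //= hornerXsubC subrr mul0r.
Qed.

Definition lagrange c : {poly F} :=
  \prod_(c' | c' != c) ((z c - z c')^-1 *: ('X - (z c')%:P)).

Lemma lagrangeE c c' : (lagrange c).[z c'] = (c == c')%:R.
Proof.
rewrite horner_prod; case: eqP => [<- | /eqP neq_cc'].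
  apply: big1 => d neq_dc; rewrite hornerZ hornerXsubC mulVf // subr_eq0.
  by rewrite (inj_eq z_inj) eq_sym.
by rewrite (bigD1 c') 1?eq_sym //= hornerZ hornerXsubC subrr mulr0 mul0r.
Qed.

Lemma lagrange_ideal c :
  exists a : F, ('X - (z c)%:P) * lagrange c = a *: ('X^k - 1).
Proof.
exists (\prod_(c' | c' != c) (z c - z c')^-1).
rewrite /lagrange scaler_prod -scalerAr z_roots; congr (_ *: _).
by rewrite [RHS](bigD1 c).
Qed.

(** The sum minus 1 has degree less than k and vanishes at the k roots of
unity. *)
Lemma lagrange_sum1 : \sum_c lagrange c = 1.
Proof.
apply/eqP; rewrite -subr_eq0; apply/eqP.
apply: (@roots_geq_poly_eq0 _ _ (map z (enum C))).
- apply/allP => _ /mapP[c _ ->]; rewrite rootE hornerD hornerN hornerC.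
  rewrite horner_sum (bigD1 c) //= lagrangeE eqxx big1 ?addr0 ?subrr // => d.
  by rewrite lagrangeE => /negPf->.
- by rewrite map_inj_uniq ?enum_uniq.
have k_gt0 : (0 < k)%N by rewrite lt0n; apply: contraNneq k_neq0 => ->.
rewrite size_map -cardE cardC (leq_trans (size_polyD _ _)) // geq_max.
rewrite size_polyN size_poly1 k_gt0 andbT.
apply: (leq_trans (size_sum _ _ _)); apply/bigmax_leqP => c _.
rewrite /lagrange scaler_prod (leq_trans (size_scale_leq _ _)) //.
by rewrite -big_enum size_prod_XsubC -cardE cardC1 cardC prednK.
Qed.

Definition point (nu : {ffun 'I_n -> C}) : 'I_n -> F := z \o nu.

(** Modulo the polynomials 'X_i ^+ k - 1 these are the orthogonal idempotents
that split the quotient ring into copies of F, one for each point of the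
grid. *)
Definition point_idempotent (nu : {ffun 'I_n -> C}) : {mpoly F[n]} :=
  \prod_i horner_alg 'X_i (lagrange (nu i)).

Lemma horner_algXE (v : 'I_n -> F) i (p : {poly F}) :
  (horner_alg ('X_i : {mpoly F[n]}) p).@[v] = p.[v i].
Proof.
elim/poly_ind: p => [|p c IHp]; first by rewrite !rmorph0 horner0.
rewrite !hornerE !rmorphD !rmorphM /= horner_algX mevalXU IHp horner_algC.
by rewrite mevalZ rmorph1 mulr1.
Qed.

Lemma point_idempotentE nu nu' :
  (point_idempotent nu).@[point nu'] = (nu == nu')%:R.
Proof.
rewrite rmorph_prod /=.
under eq_bigr do rewrite horner_algXE lagrangeE.
case: eqP => [-> | /eqP neq]; first by rewrite big1 // => i _; rewrite eqxx.
have /existsP[i nui] : [exists i, nu i != nu' i].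
  apply: contraNT neq => /existsPn all_eq; apply/eqP/ffunP => i.
  by have /negPn/eqP := all_eq i.
by rewrite (bigD1 i) //= (negPf nui) mul0r.
Qed.

Lemma point_idempotent_sum1 : \sum_nu point_idempotent nu = 1.
Proof.
rewrite -(bigA_distr_bigA (fun i c => horner_alg 'X_i (lagrange c))).
by rewrite big1 // => i _; rewrite -rmorph_sum lagrange_sum1 rmorph1.
Qed.

Variable e : rel 'I_n.

Local Notation I := (@coloring_ideal n k F e).

(** The polynomials p with this property form a subring, so it suffices to treat
the variables; there 'X_i minus its value supplies the factor missing from the Lagrange
polynomial in 'X_i, and completes it to a multiple of 'X_i ^+ k - 1. *)
Lemma point_idempotentX nu p :
  I ((p - (p.@[point nu])%:MP) * point_idempotent nu).
Proof.
pose J q := I ((q - (q.@[point nu])%:MP) * point_idempotent nu).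
rewrite -/(J p).
have JM q r : J q -> J r -> J (q * r).
  rewrite /J => Jq Jr; rewrite mevalM mpolyCM.
  set a := q.@[_]; set b := r.@[_].
  have -> : (q * r - a%:MP * b%:MP) * point_idempotent nu =
      q * ((r - b%:MP) * point_idempotent nu) +
      b%:MP * ((q - a%:MP) * point_idempotent nu).
    rewrite !mulrA -mulrDl; congr (_ * _).
    by rewrite mulrBr mulrBr addrA [b%:MP * q]mulrC subrK [b%:MP * _]mulrC.
  by apply: ideal_genD; apply: ideal_genM.
have JC c : J c%:MP.
  by rewrite /J mevalC subrr mul0r; apply: ideal_gen0.
have JX i : J 'X_i.
  rewrite /J mevalXU /point_idempotent (bigD1 i) //= mulrA.
  have [a Da] := lagrange_ideal (nu i).
  have -> : ('X_i - (point nu i)%:MP) * horner_alg 'X_i (lagrange (nu i))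
            = a%:MP * ('X_i ^+ k - 1) :> {mpoly F[n]}.
    have /(congr1 (horner_alg ('X_i : {mpoly F[n]}))) := Da.
    rewrite rmorphM /= linearZ /= !linearB /= horner_algX horner_algC.
    by rewrite rmorphXn /= horner_algX rmorph1 -!mul_mpolyC !mulr1.
  rewrite [_ * ('X_i ^+ k - 1)]mulrC -mulrA mulrC; apply: ideal_genMl.
  by left; exists i.
suff JS : forall s, J (\sum_(m <- s) p@_m *: 'X_[m]) by rewrite (mpolyE p).
elim=> [|m s IHs].
  by rewrite big_nil -(mpolyC0 n F); apply: JC.
rewrite big_cons /J mevalD mpolyCD opprD addrACA mulrDl.
apply: ideal_genD IHs; rewrite -mul_mpolyC; apply: (JM) => //.
rewrite mpolyXE_id; apply: (big_ind J) => [||i _].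
- by rewrite -(mpolyC1 n F).
- exact: (JM).
 elim: (m i) => [|d IHd]; first by rewrite expr0 -(mpolyC1 n F).
by rewrite exprS; apply: JM.
Qed.

Lemma edge_poly_eval (v : 'I_n -> F) i j :
  (\sum_(a < k) 'X_i ^+ (k.-1 - a) * 'X_j ^+ a).@[v] =
  \sum_(a < k) v i ^+ (k.-1 - a) * v j ^+ a.
Proof.
rewrite rmorph_sum /=; apply: eq_bigr => a _.
by rewrite mevalM !rmorphXn /= !mevalXU.
Qed.

(** For k-th roots of unity a and b, (a - b) times the sum is a ^+ k - b ^+ k = 0,
and for a = b the sum is k%:R * a ^+ k.-1, which is not 0. *)
Lemma edge_poly_point nu i j :
  ((\sum_(a < k) 'X_i ^+ (k.-1 - a) * 'X_j ^+ a).@[point nu] == 0) =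
  (nu i != nu j).
Proof.
rewrite edge_poly_eval /point /=; case: eqP => [eq0 | neq0].
  apply/esym/eqP => eq_ij; move/eqP: eq0; apply/negP; rewrite eq_ij.
  under eq_bigr => a _.
    have le_ak : (a <= k.-1)%N by rewrite -ltnS (ltn_predK (ltn_ord a)).
    rewrite -exprD subnK //; over.
  rewrite sumr_const card_ord -mulr_natl mulf_neq0 // expf_neq0 //.
  apply: contraNneq k_neq0 => z0; have := root_of_unity (nu j).
  rewrite z0 expr0n; case: eqP => [-> //|_ /eqP].
  by rewrite eq_sym oner_eq0.
apply/esym/negbTE/negPn/eqP/z_inj/eqP; rewrite -subr_eq0.
apply/negPn/negP => neq.
have := subrXX (z (nu i)) (z (nu j)) k; rewrite !root_of_unity subrr.
move/esym/eqP; rewrite mulf_eq0 (negPf neq) /= => /eqP eq0; apply: neq0.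
rewrite -[X in _ = X]eq0; apply: eq_bigr => a _.
by rewrite -subn1 -subnDA add1n.
Qed.

Lemma coloring_ideal_point nu p :
  proper_coloring e nu -> I p -> p.@[point nu] = 0.
Proof.
move=> nuP [s [Ss ->]]; rewrite rmorph_sum big_seq big1 // => t /Ss St.
rewrite rmorphM /=; apply/eqP; rewrite mulf_eq0; apply/orP; right.
case: St => [[i ->] | [i [j [eij ->]]]].
  by rewrite mevalB rmorphXn /= mevalXU rmorph1 /point /= root_of_unity subrr.
by rewrite edge_poly_point nuP.
Qed.

(** Write p as the sum of the products p * point_idempotent nu.  Modulo the ideal
each is p(nu) times the idempotent.  The coefficient is 0 when nu is proper;
otherwise an edge polynomial does not vanish at nu, and multiplying the
idempotent by it shows that the idempotent itself is in the ideal. *)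
Lemma coloring_nullstellensatz p :
  (forall nu, proper_coloring e nu -> p.@[point nu] = 0) -> I p.
Proof.
move=> p0; rewrite -[p]mulr1 -point_idempotent_sum1 mulr_sumr.
apply: ideal_gen_sum => nu.
rewrite -[p](subrK (p.@[point nu])%:MP) mulrDl.
apply: ideal_genD; first exact: point_idempotentX.
have [/proper_coloringP nuP | ] :=
    boolP [forall i, forall j, e i j ==> (nu i != nu j)].
  by rewrite p0 // mpolyC0 mul0r; apply: ideal_gen0.
rewrite negb_forall => /existsP[i]; rewrite negb_forall => /existsP[j].
rewrite negb_imply => /andP[eij]; rewrite -edge_poly_point => f_neq0.
apply: ideal_genM; set f := \sum_(_ < _) _ in f_neq0.
have If : I f by rewrite -[f]mul1r; apply: ideal_genMl; right; exists i, j.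
have -> : point_idempotent nu = (f.@[point nu])^-1%:MP *
    (point_idempotent nu * f +
     (-1) * ((f - (f.@[point nu])%:MP) * point_idempotent nu)).
  rewrite mulN1r mulrBl opprB [_ * f]mulrC addrC subrK mulrA -mpolyCM mulVf //.
  by rewrite mpolyC1 mul1r.
apply: ideal_genM; apply: ideal_genD; first exact: ideal_genM.
by apply: ideal_genM; apply: point_idempotentX.
Qed.

End Interpolation.

(** * Polynomials whose leading monomials are powers of distinct variables *)

Lemma pure_power_dvd n (i : 'I_n) d (m : 'X_{1..n}) :
  (U_(i) *+ d <= m)%MM = (d <= m i)%N.
Proof.
apply/mnm_lepP/idP => [/(_ i) | le_di j]; rewrite mulmnE mnm1E.
  by rewrite eqxx mul1n.
by case: eqP => [<- | _]; rewrite ?mul1n.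
Qed.

Section Staircase.

Variables (n : nat) (F : fieldType) (prec : rel 'X_{1..n}).
Hypothesis precP : term_order prec.

Variables (d : 'I_n -> nat) (g : 'I_n -> {mpoly F[n]}).
Hypothesis g_lm : forall i, is_lm prec (g i) (U_(i) *+ d i)%MM.
Hypothesis g_monic : forall i, (g i)@_(U_(i) *+ d i)%MM = 1.

Variables (P : finType) (v : P -> 'I_n -> F).
Hypothesis g_vanish : forall i a, (g i).@[v a] = 0.
Hypothesis v_separated :
  forall a, exists p : {mpoly F[n]}, forall b, p.@[v b] = (a == b)%:R.

Definition standard (m : 'X_{1..n}) := [forall i, m i < d i]%N.

(** Reductions of single monomials add up; Q carries a bound on the monomials
that may occur, as the induction for reduce_monomial demands. *)
Lemma reduce_terms (Q : 'X_{1..n} -> Prop) (s : seq 'X_{1..n})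
    (c : 'X_{1..n} -> F) :
  (forall m, m \in s -> exists r : {mpoly F[n]},
      (forall m', m' \in msupp r -> standard m' /\ Q m') /\
      (forall a, r.@[v a] = 'X_[m].@[v a])) ->
  exists r : {mpoly F[n]},
    (forall m', m' \in msupp r -> standard m' /\ Q m') /\
    (forall a, r.@[v a] = (\sum_(m <- s) c m *: 'X_[m]).@[v a]).
Proof.
elim: s => [|m s IHs] redP.
  by exists 0; split=> [m'|a]; rewrite ?big_nil // msupp0.
have [m' sm' | r [rQ rE]] := IHs.
  by apply: redP; rewrite inE sm' orbT.
have [|q [qQ qE]] := redP m; first by rewrite mem_head.
exists (c m *: q + r); split=> [m' | a].
  by move/msuppD_le; rewrite mem_cat => /orP[/msuppZ_le/qQ | /rQ].
by rewrite big_cons !mevalD !mevalZ rE qE.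
Qed.

(** The division algorithm, by well-founded induction on the term order: a
nonstandard m is the leading monomial of some 'X_[w] * g i, and subtracting that
product leaves the values at the given points unchanged and smaller monomials
only. *)
Lemma reduce_monomial m : exists r : {mpoly F[n]},
  (forall m', m' \in msupp r -> standard m' /\ (m' = m \/ prec m' m)) /\
  (forall a, r.@[v a] = 'X_[m].@[v a]).
Proof.
elim/(well_founded_ind (prec_wf precP)): m => m IHm.
have [std_m | ] := boolP (standard m).
  by exists 'X_[m]; split=> // m'; rewrite msuppX inE => /eqP ->; split=> //; left.
rewrite negb_forall => /existsP[i]; rewrite -leqNgt => le_di.
have [w Dm] : exists w, m = (w + U_(i) *+ d i)%MM.
  by exists (m - U_(i) *+ d i)%MM; rewrite submK // pure_power_dvd.
pose p := 'X_[m] - 'X_[w] * g i.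
have pE a : p.@[v a] = 'X_[m].@[v a].
  by rewrite mevalB mevalM g_vanish mulr0 subr0.
have supp_p m' : m' \in msupp p -> prec m' m.
  rewrite mcoeff_msupp mcoeffB mcoeffX mulrC.
  have [/mapP[u gu ->] | nin] :=
      boolP (m' \in [seq (w + u)%MM | u <- msupp (g i)]).
    rewrite mcoeffMX Dm eqm_add2l.
    case: (eqVneq (U_(i) *+ d i)%MM u) => [<- | neq_u _].
      by rewrite g_monic subrr eqxx.
    by apply: (prec_mul precP); apply: (g_lm i).2 => //; rewrite eq_sym.
  case: (eqVneq m m') => [eq_m' _ | _]; last first.
    move: nin; rewrite -(perm_mem (msuppMX _ _)) => /memN_msupp_eq0 ->.
    by rewrite subr0 eqxx.
  by case/negP: nin; rewrite -eq_m' Dm map_f // (g_lm i).1.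
have [r [rQ rE]] : exists r : {mpoly F[n]},
    (forall m', m' \in msupp r -> standard m' /\ prec m' m) /\
    (forall a, r.@[v a] = (\sum_(m' <- msupp p) p@_m' *: 'X_[m']).@[v a]).
  apply: reduce_terms => m' /supp_p lt_m'm.
  have [r [rQ rE]] := IHm _ lt_m'm; exists r; split=> // u /rQ[std_u le_um'].
  split=> //; case: le_um' => [-> // | lt_um'].
  exact: (prec_trans precP) lt_m'm.
exists r; split=> [m' /rQ[] | a]; first by split=> //; right.
by rewrite rE -mpolyE pE.
Qed.

Lemma reduce_poly (p : {mpoly F[n]}) : exists r : {mpoly F[n]},
  (forall m, m \in msupp r -> standard m) /\ (forall a, r.@[v a] = p.@[v a]).
Proof.
rewrite (mpolyE p).
have [m _ | r [rS rE]] := @reduce_terms (fun=> True) (msupp p) (fun m => p@_m).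
  have [r [rS rE]] := reduce_monomial m.
  by exists r; split=> // m' /rS[].
by exists r; split=> // m /rS[].
Qed.

(** A common bound for the exponents of standard monomials, so that they range over
a finite type and can index the columns of a matrix. *)
Let K := \max_i d i.
Definition staircase : {set {ffun 'I_n -> 'I_K}} :=
  [set f | f \in family (fun i => [pred a : 'I_K | a < d i]%N)].
Definition exponent (f : {ffun 'I_n -> 'I_K}) : 'X_{1..n} :=
  [multinom (f i : nat) | i < n].

Lemma card_staircase : #|staircase| = (\prod_i d i)%N.
Proof.
rewrite cardsE card_family foldrE big_map big_enum; apply: eq_bigr => i _.
have le_dK : (d i <= K)%N by apply: (leq_bigmax i).
rewrite -[RHS]card_ord -[RHS]sum1_card (big_ord_widen K (fun=> 1%N)) //.
by rewrite -sum1_card.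
Qed.

Lemma standard_expand (r : {mpoly F[n]}) :
  (forall m, m \in msupp r -> standard m) ->
  r = \sum_(f in staircase) r@_(exponent f) *: 'X_[exponent f].
Proof.
have exponent_inj : injective exponent.
  move=> f f' /mnmP eq_ff'; apply/ffunP => i; apply/val_inj.
  by have := eq_ff' i; rewrite !mnmE.
move=> r_std; apply/mpolyP => m; rewrite raddf_sum /=.
have [std_m | nstd_m] := boolP (standard m).
  have ltK i : (m i < K)%N.
    by apply: (leq_trans (forallP std_m i)); apply: (leq_bigmax i).
  have Dm : m = exponent [ffun i => Ordinal (ltK i)].
    by apply/mnmP => i; rewrite mnmE ffunE.
  rewrite {2}Dm (bigD1 [ffun i => Ordinal (ltK i)]) /=; last first.
    by rewrite inE; apply/familyP => i; rewrite inE ffunE; apply: (forallP std_m).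
  rewrite -Dm mcoeffZ mcoeffX eqxx mulr1 big1 ?addr0 // => f /andP[_ neq_f].
  rewrite mcoeffZ mcoeffX [in X in X%:R]Dm (inj_eq exponent_inj).
  by rewrite (negPf neq_f) mulr0.
rewrite memN_msupp_eq0; last by apply: contra nstd_m; apply: r_std.
rewrite big1 // => f; rewrite inE => /familyP std_f.
rewrite mcoeffZ mcoeffX; case: eqP => [Dm | _]; last by rewrite mulr0.
case/negP: nstd_m; rewrite -Dm; apply/forallP => i.
by have := std_f i; rewrite inE mnmE.
Qed.

Definition evaluation_mx : 'M[F]_(#|P|, #|staircase|) :=
  \matrix_(a, b) 'X_[exponent (enum_val b)].@[v (enum_val a)].

Lemma evaluation_mxE (r : {mpoly F[n]}) :
  (forall m, m \in msupp r -> standard m) ->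
  evaluation_mx *m \col_b r@_(exponent (enum_val b)) =
  \col_a r.@[v (enum_val a)].
Proof.
move=> /standard_expand Dr; apply/colP => a; rewrite !mxE [in RHS]Dr.
rewrite rmorph_sum /=
  (big_enum_val (fun f => (r@_(exponent f) *: 'X_[exponent f]).@[v _])).
by apply: eq_bigr => b _; rewrite !mxE mevalZ mulrC.
Qed.

(** A right inverse is given by the coefficients of the reductions of polynomials
that separate the points. *)
Lemma evaluation_row_free : row_free evaluation_mx.
Proof.
apply/row_freeP.
have /fin_all_exists[q qP] : forall a : P, exists r : {mpoly F[n]},
    (forall m, m \in msupp r -> standard m) /\ forall b, r.@[v b] = (a == b)%:R.
  move=> a; have [p pE] := v_separated a; have [r [rS rE]] := reduce_poly p.
  by exists r; split=> // b; rewrite rE.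
exists (\matrix_(b, a) (q (enum_val a))@_(exponent (enum_val b))).
apply/matrixP => a b.
have [qS qE] := qP (enum_val b).
have := evaluation_mxE qS => /colP/(_ a); rewrite !mxE qE (inj_eq enum_val_inj).
rewrite [b == a]eq_sym => <-.
by apply: eq_bigr => c _; rewrite !mxE.
Qed.

Lemma card_points_le : (#|P| <= \prod_i d i)%N.
Proof.
have /eqP <- := evaluation_row_free.
by rewrite -card_staircase rank_leq_col.
Qed.

(** With as many points as standard monomials, the evaluation matrix is square,
hence invertible. *)
Hypothesis card_points : #|P| = (\prod_i d i)%N.

Lemma standard_vanish (r : {mpoly F[n]}) :
  (forall m, m \in msupp r -> standard m) -> (forall a, r.@[v a] = 0) -> r = 0.
Proof.
move=> r_std r0.
have /row_fullP[B BE] : row_full evaluation_mx.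
  rewrite /row_full; have /eqP -> := evaluation_row_free.
  by rewrite card_staircase card_points.
have := evaluation_mxE r_std.
move/(congr1 (mulmx B)); rewrite mulmxA BE mul1mx.
have -> : \col_a r.@[v (enum_val a)] = 0 :> 'cV[F]_#|P|.
  by apply/colP => a; rewrite !mxE r0.
rewrite mulmx0 => /colP cr0.
rewrite (standard_expand r_std) big_enum_val big1 // => b _.
by have := cr0 b; rewrite !mxE => ->; rewrite scale0r.
Qed.

(** If m were standard, reducing the other terms of f, which are smaller than m,
would give a combination of standard monomials that vanishes at all points and
has a nonzero coefficient at m. *)
Lemma lm_vanish_not_standard (f : {mpoly F[n]}) m :
  (forall a, f.@[v a] = 0) -> is_lm prec f m -> ~~ standard m.
Proof.
move=> f0 [fm lm_m]; apply/negP => std_m.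
have [r [rQ rE]] : exists r : {mpoly F[n]},
    (forall m', m' \in msupp r -> standard m' /\ prec m' m) /\
    (forall a,
       r.@[v a] = (\sum_(m' <- rem m (msupp f)) f@_m' *: 'X_[m']).@[v a]).
  apply: reduce_terms => m'; rewrite mem_rem_uniq ?msupp_uniq // !inE.
  move=> /andP[neq_m' fm'].
  have lt_m'm := lm_m _ fm' neq_m'; have [r [rQ rE]] := reduce_monomial m'.
  exists r; split=> // u /rQ[std_u le_um'].
  split=> //; case: le_um' => [-> // | lt_um'].
  exact: (prec_trans precP) lt_m'm.
have /(congr1 (mcoeff m)) : f@_m *: 'X_[m] + r = 0.
  apply: standard_vanish => [m' | a].
    move/msuppD_le; rewrite mem_cat => /orP[/msuppZ_le | /rQ[] //].
    by rewrite msuppX inE => /eqP ->.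
  have := mpolyE f; rewrite (big_rem m fm) /= => Df.
  by rewrite mevalD rE -mevalD -Df f0.
rewrite mcoeffD mcoeffZ mcoeffX eqxx mulr1 mcoeff0 => /eqP.
have [rm | /memN_msupp_eq0 ->] := boolP (m \in msupp r).
  by have [_] := rQ _ rm; rewrite (prec_irr precP).
by rewrite addr0; apply/negP; rewrite -mcoeff_msupp.
Qed.

End Staircase.

(** * Complete homogeneous polynomials at roots of unity *)

Section CompleteSymmetric.

Variables (n : nat) (F : fieldType).
Implicit Types (U : {set 'I_n}) (m : 'X_{1..n}).

Definition monomial_over U m := [forall i, (i \notin U) ==> (m i == 0%N)].

Lemma mcoeff_hsym U d m :
  (hsym F U d)@_m = ((mdeg m == d) && monomial_over U m)%:R.
Proof.
rewrite raddf_sum /=.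
have [/andP[deg_m over_m] | not_m] := boolP (_ && _).
  have lt_md : (mdeg m < d.+1)%N by rewrite (eqP deg_m).
  rewrite (bigD1 (BMultinom lt_md)) /=; last by rewrite deg_m.
  rewrite mcoeffX eqxx big1 ?addr0 // => m' /andP[_ neq_m'].
  by rewrite mcoeffX (_ : (_ == _) = false) //; apply: contraNF neq_m'.
rewrite big1 // => m' m'P; rewrite mcoeffX; case: eqP => // Dm.
by rewrite Dm -/(monomial_over U m) (negPf not_m) in m'P.
Qed.

Lemma hsym_deg0 U : hsym F U 0 = 1.
Proof.
apply/mpolyP => m; rewrite mcoeff_hsym mcoeff1 mdeg_eq0.
case: eqP => //= ->; suff -> : monomial_over U 0%MM by [].
by apply/forallP => i; rewrite mnm0E eqxx implybT.
Qed.

Lemma hsym_set0 d : hsym F (set0 : {set 'I_n}) d.+1 = 0.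
Proof.
apply/mpolyP => m; rewrite mcoeff_hsym mcoeff0; case: andP => // -[deg_m over_m].
have m0 : m = 0%MM.
  apply/mnmP => i; rewrite mnm0E.
  by move/forallP/(_ i): over_m; rewrite inE => /eqP.
by rewrite m0 mdeg0 in deg_m.
Qed.

(** The monomials of degree d.+1 either avoid 'X_a or are divisible by it. *)
Lemma hsym_rec a U d : a \notin U ->
  hsym F (a |: U) d.+1 = hsym F U d.+1 + 'X_a * hsym F (a |: U) d.
Proof.
move=> aU; apply/mpolyP => m; rewrite mcoeffD !mcoeff_hsym mulrC.
have [ma0 | ma_neq0] := eqVneq (m a) 0%N.
  have -> : (hsym F (a |: U) d * 'X_a)@_m = 0.
    apply: memN_msupp_eq0; rewrite (perm_mem (msuppMX _ _)).
    apply/mapP => -[m' _ Dm].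
    by move: ma0; rewrite Dm mnmDE mnm1E eqxx.
  rewrite addr0; congr ((_ && _)%:R); apply/forallP/forallP => over_m i.
    have := over_m i; rewrite !inE; case: eqP => // -> _.
    by rewrite ma0 implybT.
  by apply/implyP; rewrite !inE negb_or => /andP[_]; apply/implyP.
have -> : monomial_over U m = false.
  by apply/forallP => /(_ a); rewrite aU (negPf ma_neq0).
have Dm : m = (U_(a) + (m - U_(a)))%MM.
  by rewrite addmC submK // lep1mP.
rewrite andbF add0r [in RHS]Dm mcoeffMX mcoeff_hsym.
rewrite [in mdeg _]Dm mdegD mdeg1 add1n eqSS.
congr ((_ && _)%:R); apply: eq_forallb => i; rewrite !inE mnmBE mnm1E.
by case: (eqVneq a i) => //= _; rewrite subn0.
Qed.

Lemma hsym_set1 a d (v : 'I_n -> F) : (hsym F [set a] d).@[v] = v a ^+ d.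
Proof.
elim: d => [|d IHd]; first by rewrite hsym_deg0 rmorph1.
have := @hsym_rec a set0 d; rewrite setU0 inE => -> //.
by rewrite hsym_set0 add0r mevalM mevalXU IHd exprS.
Qed.

(** Write h_U^d for the value at v.  Removing either of two elements a, b of U with
hsym_rec gives the divided difference identity
  (v a - v b) * h_U^d = h_(U :\ b)^(d+1) - h_(U :\ a)^(d+1),
whose right side is 0, because by induction on the cardinal both terms have the
same value.  The value is 1 for singletons, where it is a k-th power. *)
Lemma hsym_roots_of_unity u U d k (v : 'I_n -> F) :
    #|U| = u.+1 -> (u + d)%N = k -> {in U &, injective v} ->
    (forall i, i \in U -> v i ^+ k = 1) ->
  (hsym F U d).@[v] = (u == 0%N)%:R.
Proof.
elim: u U d => [|u IHu] U d cardU Dk.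
  move/eqP/cards1P: cardU Dk => [a ->] <- _ v_root.
  by rewrite hsym_set1 v_root ?set11.
move=> v_inj v_root.
have /card_gt1P[a [b [aU bU neq_ab]]] : (1 < #|U|)%N by rewrite cardU.
have rec c : c \in U -> (hsym F U d.+1).@[v] =
    (u == 0%N)%:R + v c * (hsym F U d).@[v].
  move=> cU; rewrite -{1}(setD1K cU) hsym_rec ?setD11 // setD1K //.
  rewrite mevalD mevalM mevalXU IHu //.
  - by have := cardsD1 c U; rewrite cU cardU add1n => -[<-].
  - by rewrite -addSnnS.
  - by move=> i j /setD1P[_ iU] /setD1P[_ jU]; apply: v_inj.
  - by move=> i /setD1P[_ iU]; apply: v_root.
have := rec a aU; rewrite (rec b bU) => /addrI/eqP.
rewrite -subr_eq0 -mulrBl mulf_eq0 subr_eq0 => /orP[/eqP/v_inj | /eqP -> //].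
by move/(_ bU aU)/eqP; rewrite eq_sym (negPf neq_ab).
Qed.

End CompleteSymmetric.

(** * The maxima of the color classes *)

Section ClassMaxima.

Variables (n : nat) (C : finType) (nu : {ffun 'I_n -> C}).
Local Notation M := (class_maxima nu).

Lemma max_class_color i : nu (max_class nu i) = nu i.
Proof.
rewrite /max_class; case: arg_maxnP; first by rewrite inE.
by move=> j; rewrite inE => /eqP.
Qed.

Lemma max_class_ge i j : nu j = nu i -> (j <= max_class nu i)%N.
Proof.
move=> nu_ji; rewrite /max_class; case: arg_maxnP; first by rewrite inE.
by move=> m _; apply; rewrite inE nu_ji.
Qed.

Lemma max_class_eq i j : nu i = nu j -> max_class nu i = max_class nu j.
Proof.
move=> nu_ij; apply/val_inj/anti_leq.
by rewrite !max_class_ge ?max_class_color.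
Qed.

Lemma mem_maxima i : (i \in M) = (max_class nu i == i).
Proof. by rewrite mem_filter mem_enum andbT. Qed.

Lemma max_class_maxima i : max_class nu i \in M.
Proof. by rewrite mem_maxima; apply/eqP/max_class_eq/max_class_color. Qed.

Lemma maxima_inj : {in M &, injective nu}.
Proof.
move=> i j; rewrite !mem_maxima => /eqP Mi /eqP Mj /max_class_eq.
by rewrite Mi Mj.
Qed.

Lemma maxima_uniq : uniq M.
Proof. by rewrite filter_uniq ?enum_uniq. Qed.

Lemma size_maxima : size M = #|codom nu|.
Proof.
rewrite -(size_map nu) -(card_uniqP _); last first.
  by rewrite map_inj_in_uniq ?maxima_uniq //; apply: maxima_inj.
apply: eq_card => c; apply/mapP/codomP => [[i _ ->] | [i ->]]; first by exists i.
by exists (max_class nu i); rewrite ?max_class_maxima ?max_class_color.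
Qed.

Lemma maxima_sorted : sorted (fun i j : 'I_n => (i < j)%N) M.
Proof.
apply: sorted_filter => [j i l | ]; first exact: ltn_trans.
have := iota_ltn_sorted 0 n; rewrite -val_enum_ord.
by rewrite sorted_map.
Qed.

Lemma maxima_index_lt i j :
  i \in M -> j \in M -> (index i M < index j M)%N -> (i < j)%N.
Proof.
have trans : transitive (fun i j : 'I_n => (i < j)%N).
  by move=> j' i' l; apply: ltn_trans.
exact: (sorted_ltn_index trans maxima_sorted).
Qed.

Lemma mem_drop_maxima p j : j \in drop p M -> j \in M /\ (p <= index j M)%N.
Proof.
move=> jM; split; first exact: mem_drop jM.
case/(nthP j): jM => q; rewrite size_drop => lt_q <-.
by rewrite nth_drop index_uniq ?maxima_uniq ?leq_addr -?ltn_subRL.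
Qed.

(** The exponent d_i in the leading monomial 'X_i ^+ d_i of nu_poly nu i, when all
k colors are used: then the last maximum m_k has the same exponent k as in
'X_i ^+ k - 1. *)
Definition lm_degree (i : 'I_n) : nat :=
  if i \in M then (index i M).+1 else 1.

Lemma lm_degree_gt0 i : (0 < lm_degree i)%N.
Proof. by rewrite /lm_degree; case: ifP. Qed.

Lemma prod_lm_degree : (\prod_i lm_degree i)%N = #|codom nu|`!.
Proof.
rewrite (bigID (mem M)) /= [X in (_ * X)%N]big1 ?muln1; last first.
  by move=> i /negPf iM; rewrite /lm_degree iM.
under eq_bigr => i iM do rewrite /lm_degree iM.
rewrite -big_uniq ?maxima_uniq //= fact_prod big_add1 /= -size_maxima.
case D: M => [|i0 s]; first by rewrite big_nil big_geq.
rewrite -D (big_nth i0) big_mkord big_mkord; apply: eq_bigr => j _.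
by rewrite index_uniq ?maxima_uniq.
Qed.

(** * Leading monomials and zeros of the reduced basis *)

Section Polynomials.

Variables (k : nat) (F : fieldType).
Hypotheses (k_gt1 : (1 < k)%N) (codom_nu : #|codom nu| = k).

Local Notation g := (nu_poly k F nu).

Let szM : size M = k.
Proof. by rewrite size_maxima. Qed.

Let last_mem i : last i M \in M.
Proof. by rewrite -nth_last mem_nth // szM; case: k k_gt1. Qed.

Let lm_degree_last i : i = last i M -> lm_degree i = k.
Proof.
move=> Di; rewrite /lm_degree {1}Di last_mem Di -nth_last.
rewrite index_uniq ?maxima_uniq //.
  by rewrite szM prednK // ltnW.
by rewrite szM; case: k k_gt1.
Qed.

Let mem_behead j : j \in behead M -> j \in M /\ (0 < index j M)%N.
Proof. by rewrite -drop1 => /mem_drop_maxima. Qed.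

(** The two cases of the definition that involve complete homogeneous polynomials
behave alike: in both, one vertex is taken from each class of a set of
k + 1 - d_i classes, i is the first of them, and the others are maxima m_j with
j > d_i. *)
Inductive nu_poly_spec (i : 'I_n) : {mpoly F[n]} -> Prop :=
| NuPolyLast of i = last i M & lm_degree i = k : nu_poly_spec i ('X_i ^+ k - 1)
| NuPolySym (U : {set 'I_n}) of i \in U & (#|U| + lm_degree i)%N = k.+1
    & (lm_degree i < k)%N
    & {in U &, injective nu}
    & (forall j, j \in U -> j != i ->
         (i < j)%N /\ (lm_degree i < lm_degree j)%N) :
    nu_poly_spec i (hsym F U (lm_degree i))
| NuPolyLin j of nu i = nu j & (i < j)%N & lm_degree i = 1%N
    & (1 < lm_degree j)%N :
    nu_poly_spec i ('X_i - 'X_j).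

Lemma nu_polyP (i : 'I_n) : nu_poly_spec i (g i).
Proof.
rewrite /nu_poly; case: eqP => [Di | /eqP i_last].
  by constructor=> //; apply: lm_degree_last.
case: ifP => [iM | iM].
  have Ddeg : lm_degree i = (index i M).+1 by rewrite /lm_degree iM.
  have lt_deg : (lm_degree i < k)%N.
    rewrite Ddeg ltn_neqAle -{2}szM index_mem iM andbT.
    apply: contraNneq i_last => Dk.
    by rewrite -nth_last szM -Dk /= nth_index.
  rewrite -Ddeg; apply: NuPolySym => //.
  - by rewrite inE (drop_nth i) ?index_mem // nth_index // mem_head.
  - rewrite cardsE (card_uniqP _) ?drop_uniq ?maxima_uniq // size_drop.
    rewrite szM Ddeg addnS.
    by rewrite subnK // -szM ltnW // index_mem.
  - move=> j l; rewrite !inE => /mem_drop_maxima[jM _] /mem_drop_maxima[lM _].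
    exact: maxima_inj.
  move=> j; rewrite inE => /mem_drop_maxima[jM le_ij] neq_ji.
  have lt_ij : (index i M < index j M)%N.
    rewrite ltn_neqAle le_ij andbT; apply: contraNneq neq_ji => eq_ind.
    by rewrite -[j](nth_index i jM) -eq_ind nth_index.
  by rewrite (maxima_index_lt iM jM lt_ij) Ddeg /lm_degree jM ltnS.
have Ddeg : lm_degree i = 1%N by rewrite /lm_degree iM.
have lt_i : (i < max_class nu i)%N.
  rewrite ltn_neqAle max_class_ge // andbT.
  by apply: contraFneq iM => Di; rewrite mem_maxima; apply/eqP/val_inj.
case: ifP => i_first; rewrite inE in i_first.
  have nu_i := eqP i_first.
  rewrite -[X in hsym F _ X]Ddeg.
  have headM : head i M \in M by rewrite -nth0 mem_nth // szM ltnW.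
  have Dhead : max_class nu i = head i M.
    by rewrite (max_class_eq nu_i); apply/eqP; rewrite -mem_maxima.
  have head_index : index (head i M) M = 0%N.
    by rewrite -nth0 index_uniq ?maxima_uniq // szM ltnW.
  apply: NuPolySym => //.
  - exact: setU11.
  - rewrite cardsU1 inE (contraFN _ iM); last by case/mem_behead.
    rewrite cardsE (card_uniqP _); last first.
      by rewrite -drop1 drop_uniq ?maxima_uniq.
    by rewrite size_behead szM Ddeg addn1 add1n prednK // ltnW.
  - by rewrite Ddeg.
  - have neq_i j : j \in behead M -> nu j != nu i.
      case/mem_behead=> jM j_gt0; rewrite nu_i; apply: contraTneq j_gt0.
      by move/(maxima_inj jM headM) ->; rewrite head_index.
    move=> j l; rewrite !inE => /predU1P[-> | jM] /predU1P[-> | lM] //.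
    + by move/esym/eqP; rewrite (negPf (neq_i l lM)).
    + by move/eqP; rewrite (negPf (neq_i j jM)).
    + by apply: maxima_inj; [case/mem_behead: jM | case/mem_behead: lM].
  move=> j; rewrite !inE => /predU1P[-> | /mem_behead[jM j_gt0] _].
    by rewrite eqxx.
  rewrite Ddeg /lm_degree jM ltnS; split=> //; apply: (ltn_trans lt_i).
  by rewrite Dhead maxima_index_lt // head_index.
apply: NuPolyLin => //; rewrite ?max_class_color //.
rewrite /lm_degree max_class_maxima ltnS lt0n; apply: contraFneq i_first => ind0.
by rewrite -nth0 -ind0 nth_index ?max_class_maxima ?max_class_color.
Qed.

Lemma nu_poly_monic i : (g i)@_(U_(i) *+ lm_degree i) = 1.
Proof.
case: nu_polyP => [_ -> | U iU _ _ _ _ | j _ lt_ij -> _].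
- rewrite mcoeffB mcoeffXn eqxx mcoeff1 -mdeg_eq0 mdegMn mdeg1 mul1n.
  by rewrite (gtn_eqF (ltnW k_gt1)) subr0.
- rewrite mcoeff_hsym mdegMn mdeg1 mul1n eqxx (_ : monomial_over _ _) //.
  apply/forallP => j; apply/implyP => jU; rewrite mulmnE mnm1E.
  by case: (eqVneq i j) jU => [<- | //]; rewrite iU.
rewrite mulm1n mcoeffB !mcoeffXU eqxx (_ : (j == i) = false) ?subr0 //.
by apply: contraTF lt_ij => /eqP ->; rewrite ltnn.
Qed.

(** What the comparison of monomials in nu_poly_lm and the divisibility conditions
in nu_poly_reduced have in common. *)
Lemma nu_poly_supp i m :
    m \in msupp (g i) -> m != (U_(i) *+ lm_degree i)%MM ->
  m = 0%MM \/ mdeg m = lm_degree i /\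
    forall j, m j != 0%N -> j != i ->
      (i < j)%N /\ (lm_degree i < lm_degree j)%N.
Proof.
case: nu_polyP => [_ -> | U iU _ _ _ UP | j _ lt_ij -> lt1j].
- move/msuppB_le; rewrite mem_cat msupp1 inE => /orP[|/eqP ->]; last by left.
  rewrite mcoeff_msupp mcoeffXn => + /negPf neq.
  by rewrite [_ == m]eq_sym neq eqxx.
- rewrite mcoeff_msupp mcoeff_hsym.
  case: andP => [[/eqP deg_m over_m] _ _|]; last by rewrite eqxx.
  right; split=> // j mj; apply: UP; apply: contraNT mj => jU.
  by have /forallP/(_ j)/implyP/(_ jU) := over_m.
rewrite mulm1n => /msuppB_le; rewrite mem_cat !msuppX !inE.
move=> /orP[-> // | /eqP ->] _.
right; rewrite mdeg1; split=> // l; rewrite mnm1E.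
by case: (eqVneq j l) => [<- | //].
Qed.

Lemma nu_poly_vanish (v : 'I_n -> F) i :
    (forall j, v j ^+ k = 1) -> (forall j l, v j = v l <-> nu j = nu l) ->
  (g i).@[v] = 0.
Proof.
move=> v_root v_nu.
case: nu_polyP => [_ _ | U iU cardU lt_dk U_inj _ | j /v_nu v_ij _ _ _].
- by rewrite mevalB rmorphXn /= mevalXU rmorph1 v_root subrr.
- have Du : #|U| = #|U :\ i|.+1 by rewrite (cardsD1 i U) iU.
  have Dk : (#|U :\ i| + lm_degree i)%N = k.
    by move: cardU; rewrite Du addSn => -[].
  rewrite (hsym_roots_of_unity Du Dk) //.
    by case: eqP Dk => // -> Dk; rewrite -Dk ltnn in lt_dk.
  by move=> j l jU lU /v_nu /U_inj; apply.
by rewrite mevalB !mevalXU v_ij subrr.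
Qed.

Section LeadingMonomials.

Variable prec : rel 'X_{1..n}.
Hypotheses (precP : term_order prec)
  (prec_vars : forall i j : 'I_n, (i < j)%N -> prec U_(j)%MM U_(i)%MM).

(** Among the monomials of degree d in 'X_i and smaller variables the largest is
'X_i ^+ d: split off one variable and use induction on d. *)
Lemma prec_pure_power (i : 'I_n) (m : 'X_{1..n}) :
    (forall j, m j != 0%N -> j != i -> (i < j)%N) ->
  m != (U_(i) *+ mdeg m)%MM -> prec m (U_(i) *+ mdeg m)%MM.
Proof.
move D: (mdeg m) => d; elim: d m D => [|d IHd] m deg_m over_m.
  by rewrite mulm0n -mdeg_eq0 deg_m eqxx.
have [j mj] : exists j, m j != 0%N.
  apply/existsP; rewrite -[[exists _, _]]negbK negb_exists.
  apply/negP => /forallP m0.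
  suff m_eq0 : m = 0%MM by rewrite m_eq0 mdeg0 in deg_m.
  by apply/mnmP => j; rewrite mnm0E; apply/eqP; have := m0 j; rewrite negbK.
have Dm : m = (U_(j) + (m - U_(j)))%MM by rewrite addmC submK // lep1mP.
set m' := (m - U_(j))%MM in Dm.
have deg_m' : mdeg m' = d by move: deg_m; rewrite Dm mdegD mdeg1 => -[].
have over_m' l : m' l != 0%N -> l != i -> (i < l)%N.
  by move=> ml; apply: over_m; rewrite Dm mnmDE addn_eq0 negb_and ml orbT.
have le_j : j = i \/ prec U_(j)%MM U_(i)%MM.
  by case: (eqVneq j i) => [|neq_ji]; [left | right; apply/prec_vars/over_m].
rewrite mulmS Dm => neq.
have [Dm' | neq_m'] := eqVneq m' (U_(i) *+ d)%MM.
  case: le_j => [Dj | lt_ji]; first by rewrite Dm' Dj eqxx in neq.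
  by rewrite Dm' ![(_ + U_(i) *+ d)%MM]addmC; apply: (prec_mul precP).
have lt_m' : prec (U_(j) + m')%MM (U_(j) + U_(i) *+ d)%MM.
  by apply: (prec_mul precP); apply: IHd.
case: le_j => [Dj | lt_ji]; first by rewrite -{1}Dj.
apply: (prec_trans precP) lt_m' _.
by rewrite ![(_ + U_(i) *+ d)%MM]addmC; apply: (prec_mul precP).
Qed.

Lemma nu_poly_lm i : is_lm prec (g i) (U_(i) *+ lm_degree i)%MM.
Proof.
split=> [|m gm neq_m].
  by rewrite mcoeff_msupp nu_poly_monic oner_neq0.
case: (nu_poly_supp gm neq_m) => [-> | [deg_m over_m]].
  apply: (prec_min precP); rewrite -mdeg_eq0 mdegMn mdeg1 mul1n.
  by rewrite -lt0n lm_degree_gt0.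
rewrite -deg_m; apply: prec_pure_power => [j mj neq_j|]; last by rewrite deg_m.
by case: (over_m j mj neq_j).
Qed.

Lemma is_lm_uniq (p : {mpoly F[n]}) m m' :
  is_lm prec p m -> is_lm prec p m' -> m = m'.
Proof.
move=> [pm lm_m] [pm' lm_m']; apply/eqP/negPn/negP => neq.
have lt_mm' := lm_m' _ pm neq.
have lt_m'm := lm_m _ pm' (contra_neq esym neq).
by have := prec_trans precP lt_mm' lt_m'm; rewrite (prec_irr precP).
Qed.

(** In a nonleading monomial of g i', a variable 'X_i other than 'X_i' occurs only
if d_i exceeds d_i', which is the degree of the whole monomial. *)
Lemma nu_poly_reduced i i' m m' : i != i' ->
  is_lm prec (g i) m -> m' \in msupp (g i') -> ~~ (m <= m')%MM.
Proof.
move=> neq_ii' /(is_lm_uniq (nu_poly_lm i)) <- gm'.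
rewrite pure_power_dvd; apply/negP.
have [-> | neq_m'] := eqVneq m' (U_(i') *+ lm_degree i')%MM.
  by rewrite mulmnE mnm1E eq_sym (negPf neq_ii') leqNgt lm_degree_gt0.
case: (nu_poly_supp gm' neq_m') => [-> | [deg_m' over_m'] le_d].
  by rewrite mnm0E leqNgt lm_degree_gt0.
have m'i : m' i != 0%N by rewrite -lt0n (leq_trans (lm_degree_gt0 i)).
have [_] := over_m' i m'i neq_ii'; rewrite -deg_m' => lt_d.
have : (mdeg m' < m' i)%N by apply: leq_trans le_d.
by rewrite ltnNge mdegE (bigD1 i) //= leq_addr.
Qed.

End LeadingMonomials.

End Polynomials.

End ClassMaxima.

(** * The graded lexicographic order *)

Lemma grlex_term_order n : term_order (<%O : rel 'X_{1..n}).
Proof.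
split.
- exact: Order.POrderTheory.ltxx.
- by move=> u v w; apply: Order.POrderTheory.lt_trans.
- by move=> u v; rewrite Order.TotalTheory.neq_lt.
- exact: ltom_wf.
- by move=> u v w; rewrite ltmc_add2r.
- by move=> u; rewrite Order.POrderTheory.lt_neqAle le0m eq_sym => ->.
Qed.

Lemma grlex_vars n (i j : 'I_n) : (i < j)%N -> (U_(j)%MM < U_(i)%MM)%O.
Proof.
move=> lt_ij; apply/ltmcP; first by rewrite !mdeg1.
have neq (l l' : 'I_n) : (l < l')%N -> (l' == l) = false.
  by move=> lt_l; apply: contraTF lt_l => /eqP ->; rewrite ltnn.
exists i => [l lt_li|]; rewrite !mnm1E ?eqxx !neq //.
exact: ltn_trans lt_ij.
Qed.

(** * Permuting the colors *)

Section Recoloring.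

Variables (n : nat) (C : finType) (e : rel 'I_n).

Definition recolor (nu : {ffun 'I_n -> C}) (s : {perm C}) : {ffun 'I_n -> C} :=
  [ffun i => s (nu i)].

Lemma recolor_proper nu s :
  proper_coloring e nu -> proper_coloring e (recolor nu s).
Proof. by move=> nuP i j eij; rewrite !ffunE (inj_eq perm_inj) nuP. Qed.

Lemma codom_full (nu : {ffun 'I_n -> C}) c :
  #|codom nu| = #|C| -> exists i, nu i = c.
Proof.
move=> card_nu; have /subset_leqif_card := subset_predT (mem (codom nu)).
case=> _; rewrite card_nu eqxx => /esym/subsetP/(_ c isT)/codomP[i ->].
by exists i.
Qed.

Lemma recolor_inj (nu : {ffun 'I_n -> C}) :
  #|codom nu| = #|C| -> injective (recolor nu).
Proof.
move=> card_nu s t /ffunP eq_st; apply/permP => c.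
by have [i <-] := codom_full c card_nu; have := eq_st i; rewrite !ffunE.
Qed.

Lemma card_all_perm : #|{: {perm C}}| = #|C|`!.
Proof.
rewrite -cardsT -(card_perm [set: C]); apply: eq_card => s.
by rewrite !inE; apply/esym/subsetP => c _; rewrite inE.
Qed.

(** If a color is unused, two of the more than #|C| vertices share a color; giving
the unused color to one of them separates two vertices that no permutation of
the colors can separate. *)
Lemma uniquely_colorable_codom (nu : {ffun 'I_n -> C}) :
    (#|C| < n)%N -> irreflexive e -> proper_coloring e nu ->
    (forall nu', proper_coloring e nu' ->
       exists s : {perm C}, forall i, nu' i = s (nu i)) ->
  #|codom nu| = #|C|.
Proof.
move=> lt_Cn e_irr nuP nu_unique.
apply/eqP; rewrite eqn_leq max_card /= leqNgt; apply/negP => lt_nu.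
have /existsP[c c_unused] : [exists c, c \notin codom nu].
  rewrite -negb_forall; apply: contraL lt_nu => /forallP nu_full.
  by rewrite -leqNgt; apply/subset_leq_card/subsetP => c _.
have /injectivePn[i [j neq_ij eq_ij]] : ~~ injectiveb nu.
  apply: contraL lt_Cn => /injectiveP/card_codom; rewrite card_ord -leqNgt => <-.
  exact: max_card.
have [a b eab | s Ds] := nu_unique [ffun l => if l == i then c else nu l].
  rewrite !ffunE.
  case: (eqVneq a i) eab => [-> | _]; case: (eqVneq b i) => [-> | _].
  - by rewrite e_irr.
  - by move=> _; apply: contraNneq c_unused => ->; apply: codom_f.
  - by move=> _; apply: contraNneq c_unused => <-; apply: codom_f.
  - exact: nuP.
have := Ds i; have := Ds j; rewrite !ffunE eqxx [j == i]eq_sym (negPf neq_ij).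
rewrite eq_ij => <- Dc; case/negP: c_unused; rewrite Dc; exact: codom_f.
Qed.

End Recoloring.

(** * Unique colorability and the reduced basis *)

Section Characterization.

Variables (n k : nat) (F : fieldType) (C : finType) (z : C -> F) (e : rel 'I_n).
Hypotheses (z_inj : injective z) (cardC : #|C| = k) (k_neq0 : k%:R != 0 :> F).
Hypothesis z_roots : 'X^k - 1 = \prod_c ('X - (z c)%:P).
Hypothesis k_gt1 : (1 < k)%N.

Variable prec : rel 'X_{1..n}.
Hypotheses (precP : term_order prec)
  (prec_vars : forall i j : 'I_n, (i < j)%N -> prec U_(j)%MM U_(i)%MM).

Variable nu : {ffun 'I_n -> C}.
Hypotheses (nuP : proper_coloring e nu) (codom_nu : #|codom nu| = k).

Lemma points_separated (P : finType) (col : P -> {ffun 'I_n -> C}) :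
  injective col -> forall a, exists p : {mpoly F[n]},
    forall b, p.@[point z (col b)] = (a == b)%:R.
Proof.
move=> col_inj a; exists (point_idempotent z (col a)) => b.
by rewrite (point_idempotentE z_inj) (inj_eq col_inj).
Qed.

Lemma unique_reduced_groebner :
    (forall nu', proper_coloring e nu' ->
       exists s : {perm C}, forall i, nu' i = s (nu i)) ->
  reduced_groebner_basis prec (coloring_ideal k e) (nu_basis k F nu).
Proof.
move=> nu_unique.
have lm := nu_poly_lm F k_gt1 codom_nu precP prec_vars.
have monic := nu_poly_monic F k_gt1 codom_nu.
have vanish i s : (nu_poly k F nu i).@[point z (recolor nu s)] = 0.
  apply: (nu_poly_vanish k_gt1 codom_nu) => [j | j l].
    exact: (root_of_unity z_roots).
  rewrite /point /= !ffunE; split=> [/z_inj/perm_inj // | -> //].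
have basis_sub g : g \in nu_basis k F nu -> coloring_ideal k e g.
  case/mapP=> i _ ->.
  apply: (coloring_nullstellensatz z_inj cardC k_neq0 z_roots).
  move=> nu' /nu_unique[s Ds]; suff -> : nu' = recolor nu s by [].
  by apply/ffunP => j; rewrite ffunE Ds.
(* The k`! points recolor nu s saturate the bound given by the staircase. *)
have basis_lm (f : {mpoly F[n]}) m : coloring_ideal k e f -> is_lm prec f m ->
    exists i, (lm_degree nu i <= m i)%N.
  move=> If lm_f; apply/existsP.
  suff : ~~ standard (lm_degree nu) m.
    by rewrite negb_forall; under eq_existsb do rewrite -leqNgt.
  apply: (lm_vanish_not_standard precP lm monic (P := {perm C})
           (v := fun s => point z (recolor nu s)) _ _ _ _ lm_f).
  - by move=> i s; apply: vanish.
  - by apply: points_separated; apply: recolor_inj; rewrite codom_nu.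
  - by rewrite prod_lm_degree card_all_perm codom_nu cardC.
  move=> s; apply: (coloring_ideal_point z_inj k_neq0 z_roots) If.
  exact: recolor_proper.
split.
- split=> // q; split; apply: ideal_gen_sub => _ [p [m [Bp lm_p ->]]].
    rewrite -['X_[m]]mul1r; apply: ideal_genMl.
    by exists p, m; split=> //; apply: basis_sub.
  have [i le_i] := basis_lm _ _ Bp lm_p.
  rewrite -(@submK _ (U_(i) *+ lm_degree nu i)%MM m) ?pure_power_dvd //.
  rewrite mpolyXD; apply: ideal_genMl.
  exists (nu_poly k F nu i), (U_(i) *+ lm_degree nu i)%MM; split=> //.
  by apply: map_f; rewrite mem_enum.
- move=> _ /mapP[i _ ->].
  by exists (U_(i) *+ lm_degree nu i)%MM; [apply: lm | apply: monic].
move=> _ _ m m' /mapP[i _ ->] /mapP[i' _ ->] neq_g.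
apply: (nu_poly_reduced k_gt1 codom_nu precP prec_vars).
by apply: contraNneq neq_g => ->.
Qed.

(** All proper colorings are zeros of the basis, so there are at most k`! of them;
the injection sending s to recolor nu s from the k`! permutations into them is
therefore onto. *)
Lemma groebner_unique :
  groebner_basis prec (coloring_ideal k e) (nu_basis k F nu) ->
  forall nu', proper_coloring e nu' ->
    exists s : {perm C}, forall i, nu' i = s (nu i).
Proof.
move=> [basis_sub _] nu' nu'P.
pose P := {mu : {ffun 'I_n -> C} |
            [forall i, forall j, e i j ==> (mu i != mu j)]}.
have properE (mu : {ffun 'I_n -> C}) : proper_coloring e mu ->
  [forall i, forall j, e i j ==> (mu i != mu j)] by move/proper_coloringP.
have le_P : (#|{: P}| <= #|{: {perm C}}|)%N.
  rewrite card_all_perm cardC -[X in X`!]codom_nu -prod_lm_degree.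
  apply: (@card_points_le n F prec precP (lm_degree nu) (nu_poly k F nu) _ _ P
            (fun mu => point z (val mu))).
  - exact: (nu_poly_lm F k_gt1 codom_nu precP prec_vars).
  - exact: (nu_poly_monic F k_gt1 codom_nu).
  - move=> i [mu muP].
    apply: (coloring_ideal_point z_inj k_neq0 z_roots (e := e)).
      exact/proper_coloringP.
    by apply: basis_sub; apply: map_f; rewrite mem_enum.
  - exact/points_separated/val_inj.
pose f s : P := exist _ (recolor nu s) (properE _ (recolor_proper s nuP)).
have f_inj : injective f.
  by move=> s t [/recolor_inj]; apply; rewrite codom_nu.
have /codomP[s /(congr1 val)/= ->] :=
  inj_card_onto f_inj le_P (exist _ nu' (properE _ nu'P)).
by exists s => i; rewrite ffunE.
Qed.

End Characterization.

Local Close Scope ring_scope.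

Theorem theorem1p11 (n k : nat) (F : closedFieldType) (C : finType)
    (e : rel 'I_n) (hk : 1 < k) (hkn : k < n)
    (hF : forall p : nat, (p \in [pchar F])%R -> ~~ (p %| k))
    (hC : #|C| = k) (e_sym : ssrbool.symmetric e) (e_irr : irreflexive e) :
  uniquely_colorable C e <->
  (forall prec : rel 'X_{1..n}, term_order prec ->
     (forall i j : 'I_n, i < j -> prec U_(j)%MM U_(i)%MM) ->
     exists nu : {ffun 'I_n -> C},
       [/\ proper_coloring e nu, #|codom nu| = k
         & reduced_groebner_basis prec (coloring_ideal k e)
             (nu_basis k F nu)]).
Proof.
have k_neq0 : (k%:R != 0 :> F)%R.
  rewrite natf_neq0_pchar; apply/pnatP; first exact: ltnW.
  by move=> p _ dvd_pk; apply: contraL dvd_pk => /hF.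
have := @roots_of_unity_param F C; rewrite hC => /(_ k_neq0)[z z_inj z_roots].
split=> [[nu [nuP nu_unique]] prec precP prec_vars | nu_gb].
  have codom_nu : #|codom nu| = k.
    rewrite -hC; apply: (uniquely_colorable_codom _ e_irr nuP nu_unique).
    by rewrite hC.
  exists nu; split=> //.
  exact: (unique_reduced_groebner z_inj hC k_neq0 z_roots hk precP prec_vars).
have [nu [nuP codom_nu [gb _ _]]] :=
  nu_gb _ (@grlex_term_order n) (@grlex_vars n).
exists nu; split=> //.
exact: (groebner_unique z_inj hC k_neq0 z_roots hk (@grlex_term_order n)
          (@grlex_vars n) _ codom_nu gb).
Qed.
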